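(* Let $R$ be a finite local ring. Then the complement $\overline{G}_R$ of the unitary Cayley graph $G_R$ is Ramanujan.
   Context: Rings are commutative with identity $1\neq 0$. For a finite commutative ring $R$, $R^\times$ denotes its group of units. The unitary Cayley graph $G_R$ is the graph with vertex set $R$ in which $x,y\in R$ are adjacent if and only if $x-y\in R^\times$. Its complement $\overline{G}_R$ has the same vertex set, with two distinct vertices adjacent iff they are not adjacent in $G_R$; it is $(|R|-1-|R^\times|)$-regular. A local ring is a commutative ring with a unique maximal ideal. The eigenvalues of a graph are those of its adjacency matrix. A finite $r$-regular graph is Ramanujan if every eigenvalue $\lambda$ with $\lambda\neq\pm r$ satisfies $|\lambda|\le 2\sqrt{r-1}$. *)

(* Defs.v *)
From HB Require Import structures.
From mathcomp Require Import all_boot all_order all_algebra all_field.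

Set Implicit Arguments.
Unset Strict Implicit.
Unset Printing Implicit Defensive.

Import Order.TTheory GRing.Theory Num.Theory.
Local Open Scope ring_scope.

(* The library predicate idealr_closed already requires 1 \notin I, i.e. it
   describes proper ideals. *)
Definition maximal_ideal (R : finComUnitRingType) (I : {set R}) : Prop :=
  idealr_closed I /\
  forall J : {set R}, idealr_closed J -> I \subset J -> J = I.

Definition local_ring (R : finComUnitRingType) : Prop :=
  exists! I : {set R}, maximal_ideal I.

Record sgraph (T : finType) := SGraph {
  adj :> rel T;
  adj_sym : symmetric adj;
  adj_irrefl : irreflexive adj
}.

Section Complement.
Variables (T : finType) (G : sgraph T).

Definition compl_adj : rel T := fun x y => (x != y) && ~~ adj G x y.

Lemma compl_adj_sym : symmetric compl_adj.
Proof. by move=> x y; rewrite /compl_adj eq_sym adj_sym. Qed.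

Lemma compl_adj_irrefl : irreflexive compl_adj.
Proof. by move=> x; rewrite /compl_adj eqxx. Qed.

Definition compl_graph : sgraph T := SGraph compl_adj_sym compl_adj_irrefl.

End Complement.

Section UnitaryCayley.
Variable R : finComUnitRingType.

Definition unitary_adj : rel R := fun x y => x - y \is a GRing.unit.

Lemma unitary_adj_sym : symmetric unitary_adj.
Proof. by move=> x y; rewrite /unitary_adj -unitrN opprB. Qed.

Lemma unitary_adj_irrefl : irreflexive unitary_adj.
Proof. by move=> x; rewrite /unitary_adj subrr unitr0. Qed.

Definition unitary_cayley : sgraph R :=
  SGraph unitary_adj_sym unitary_adj_irrefl.

End UnitaryCayley.

Definition regular (T : finType) (G : sgraph T) (r : nat) : Prop :=
  forall x : T, #|[set y | adj G x y]| = r.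

Definition adjacency_mx (T : finType) (G : sgraph T) : 'M[algC]_#|T| :=
  \matrix_(i, j) (adj G (enum_val i) (enum_val j))%:R.

(* Eigenvalues are taken in algC: an eigenvalue of a 0/1 matrix is an algebraic
   number. The subtraction r%:R - 1 takes place in algC, so it is not truncated
   when r = 0; sqrtC is the nonnegative square root on nonnegative reals. *)
Definition ramanujan (T : finType) (G : sgraph T) : Prop :=
  exists r : nat, regular G r /\
    forall l : algC, eigenvalue (adjacency_mx G) l ->
      l <> r%:R -> l <> - r%:R -> `|l| <= 2 * sqrtC (r%:R - 1).

(* Main.v *)
Require Import Defs.
From mathcomp Require Import all_boot all_order all_algebra all_field.

Set Implicit Arguments.
Unset Strict Implicit.
Unset Printing Implicit Defensive.

Import Order.TTheory GRing.Theory Num.Theory.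
Local Open Scope ring_scope.

(** In a local ring the non-units form an additive subgroup M, so the complement
    of the unitary Cayley graph is a disjoint union of complete graphs on the
    cosets of M. For an r-regular graph of this kind, B = A + 1 satisfies
    B^2 = (r + 1) B, which leaves only the eigenvalues r and -1. *)

Section ClusterGraph.

Variables (T : finType) (G : sgraph T) (r : nat).
Hypothesis G_reg : regular G r.

(** Needed to exclude the candidate -1 when [r = 0]: there the bound would involve the square root
    of -1. A graph without edges has zero adjacency matrix. *)
Lemma regular0_eigenvalue (l : algC) :
  r = 0%N -> eigenvalue (adjacency_mx G) l -> l = 0.
Proof.
move=> r0 /eigenvalueP [v vA v_neq0].
have A0 : adjacency_mx G = 0.
  apply/matrixP=> i j; rewrite !mxE; case Gij: (adj _ _ _) => //.
  move/eqP: (G_reg (enum_val i)); rewrite r0 cards_eq0 => /eqP/setP.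
  by move/(_ (enum_val j)); rewrite !inE Gij.
move/eqP: vA; rewrite A0 mulmx0 eq_sym scaler_eq0 (negPf v_neq0) orbF.
by move/eqP.
Qed.

Hypothesis G_trans : transitive (fun x y => (x == y) || adj G x y).

(** [A + 1] is the 0/1 matrix of the equivalence relation [E], so the [(i, j)] entry of its square
    counts the points equivalent to both ends: the whole class, of size [r.+1], if the ends are
    equivalent, and none otherwise. *)
Lemma cluster_mx_sqr :
  (adjacency_mx G + 1%:M) *m (adjacency_mx G + 1%:M)
  = r.+1%:R *: (adjacency_mx G + 1%:M).
Proof.
pose E x y := (x == y) || adj G x y.
have E_sym x y : E x y = E y x by rewrite /E eq_sym adj_sym.
have entry i j :
    (adjacency_mx G + 1%:M) i j = (E (enum_val i) (enum_val j))%:R.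
  rewrite !mxE /E (inj_eq enum_val_inj).
  by case: eqP => [->|_] /=; rewrite ?adj_irrefl ?add0r ?addr0.
apply/matrixP=> i j; rewrite mxE [RHS]mxE entry.
under eq_bigr => k _ do rewrite !entry -natrM mulnb.
rewrite -(big_enum_val (A := T) (fun z =>
  (E (enum_val i) z && E z (enum_val j))%:R)) /=.
set x := enum_val i; set y := enum_val j.
case Exy: (E x y); last first.
  rewrite mulr0 big1 // => z _.
  by case: andP => // -[Exz Ezy]; rewrite /E (G_trans Exz Ezy) in Exy.
rewrite mulr1 -natr_sum; congr (_ %:R).
have -> : r.+1 = #|x |: [set z | adj G x z]|.
  by rewrite cardsU1 inE adj_irrefl G_reg.
rewrite -sum1_card [RHS]big_mkcond; apply: eq_bigr => z _.
rewrite !inE [z == x]eq_sym -/(E x z); case Exz: (E x z) => //=.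
by rewrite /E (G_trans _ Exy) // -/(E z x) E_sym.
Qed.

(** Evaluating both sides of the quadratic identity on an eigenvector gives
    [(l + 1)^2 = (r + 1)(l + 1)]. *)
Lemma cluster_eigenvalue (l : algC) :
  eigenvalue (adjacency_mx G) l -> l = -1 \/ l = r%:R.
Proof.
move=> /eigenvalueP [v vA v_neq0].
have vB : v *m (adjacency_mx G + 1%:M) = (l + 1) *: v.
  by rewrite mulmxDr vA mulmx1 scalerDl scale1r.
have: v *m (adjacency_mx G + 1%:M) *m (adjacency_mx G + 1%:M)
      = (r.+1%:R * (l + 1)) *: v.
  by rewrite -mulmxA cluster_mx_sqr -scalemxAr vB scalerA.
rewrite vB -scalemxAl vB scalerA => /eqP.
rewrite -subr_eq0 -scalerBl scaler_eq0 (negPf v_neq0) orbF -mulrBl mulf_eq0.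
case/orP; last by rewrite addr_eq0 => /eqP; left.
by rewrite -natr1 subr_eq0 (inj_eq (addIr _)) => /eqP; right.
Qed.

Lemma cluster_ramanujan : ramanujan G.
Proof.
exists r; split=> // l l_eig l_neq_r l_neq_Nr.
case: (cluster_eigenvalue l_eig) => // l_eq.
case: (posnP r) => [r0|r_gt0].
  by case: l_neq_r; rewrite r0 (regular0_eigenvalue r0 l_eig).
(* If [r = 1], then [l = -1] is [-r], which is exempt. From [r = 2] on, the square root is at least
   1, which bounds the norm of -1. *)
have r_gt1 : (1 < r)%N.
  by rewrite ltn_neqAle r_gt0 andbT; apply/eqP=> r1; case: l_neq_Nr; rewrite -r1.
have : 1 <= sqrtC (r%:R - 1 : algC).
  rewrite -[X in X <= _]sqrtC1 ler_sqrtC ?qualifE //=.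
  - by rewrite lerBrDr -(natrD _ 1 1) ler_nat.
  - by rewrite subr_ge0 ler1n.
rewrite l_eq normrN1 => h; apply: (le_trans h).
by rewrite ler_peMl ?ler1n // (le_trans ler01 h).
Qed.

End ClusterGraph.

Section LocalRing.

Variable R : finComUnitRingType.

Lemma maximal_ideal_exists (I : {set R}) :
  idealr_closed I -> exists2 J : {set R}, maximal_ideal J & I \subset J.
Proof.
(* Since [R] is finite, being a proper ideal is decidable, and an inclusion-maximal set comes from
   [maxset_exists]. *)
pose idealb (S : {set R}) := [&& 0 \in S, 1 \notin S &
  [forall a, forall u in S, forall v in S, a * u + v \in S]].
have idealP (S : {set R}) : reflect (idealr_closed S) (idealb S).
  apply: (iffP and3P) => -[S0 S1 Sl]; split=> //.
    by move=> a u v Su Sv; move/forallP/(_ a)/forall_inP/(_ u Su)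
      /forall_inP/(_ v Sv): Sl.
  by apply/forallP=> a; apply/forall_inP=> u Su; apply/forall_inP=> v Sv; apply: Sl.
move=> /idealP/maxset_exists [J /maxsetP [/idealP J_ideal J_max] sIJ].
by exists J => //; split=> // K /idealP; apply: J_max.
Qed.

Lemma principal_idealr_closed (x : R) :
  x \isn't a GRing.unit -> idealr_closed [set a * x | a : R].
Proof.
move=> x_nonunit; split.
- by apply/imsetP; exists 0; rewrite ?mul0r.
- by apply: contra x_nonunit => /imsetP [a _ a1]; apply/unitrPr; exists a;
    rewrite mulrC.
- move=> a _ _ /imsetP [b _ ->] /imsetP [c _ ->]; apply/imsetP.
  by exists (a * b + c); rewrite // mulrDl mulrA.
Qed.

(** A nonunit generates a proper ideal, which lies in some maximal ideal, hence in the unique one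
    [M]. So [M] contains all nonunits, and a unit in [M] would put 1 there. *)
Lemma local_ring_nonunitB (x y : R) : local_ring R ->
  x \isn't a GRing.unit -> y \isn't a GRing.unit ->
  x - y \isn't a GRing.unit.
Proof.
move=> [M [[[M0 M1 Ml] _] M_uniq]].
have nonunit_M z : z \isn't a GRing.unit -> z \in M.
  move=> /principal_idealr_closed/maximal_ideal_exists [J /M_uniq <- /subsetP].
  by apply; apply/imsetP; exists 1; rewrite ?mul1r.
move=> /nonunit_M Mx /nonunit_M My; apply: contra M1 => xy_unit.
have Mxy : x - y \in M by rewrite addrC -mulN1r Ml.
by rewrite -(mulVr xy_unit) -[_ * _]addr0 Ml.
Qed.

(** The map sending [z] to [x - z] is a bijection from the nonzero nonunits to the neighbours of
    [x]. *)
Lemma compl_unitary_cayley_regular :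
  regular (compl_graph (unitary_cayley R))
    #|[set z : R | (z != 0) && (z \isn't a GRing.unit)]|.
Proof.
move=> x; rewrite -[RHS](card_imset _ (inj_comp (addrI x) oppr_inj)); apply: eq_card => y.
rewrite inE /= /compl_adj /= /unitary_adj; apply/idP/imsetP => [xy|[z + ->]] /=.
  by exists (x - y); rewrite ?inE ?subr_eq0 //= opprB addrC subrK.
rewrite inE opprD addrA subrr add0r opprK => /andP[z0 ->].
by rewrite -subr_eq0 opprD addrA subrr add0r opprK z0.
Qed.

End LocalRing.

Theorem theorem4p1 (R : finComUnitRingType) (hR : local_ring R) :
  ramanujan (compl_graph (unitary_cayley R)).
Proof.
apply: cluster_ramanujan (@compl_unitary_cayley_regular R) _.
(* The diagonal fits because 0 is a nonunit; transitivity thus becomes closure of the nonunits under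
   subtraction. *)
have adjE (x y : R) : (x == y) || adj (compl_graph (unitary_cayley R)) x y
                      = (x - y \isn't a GRing.unit).
  rewrite /= /compl_adj /= /unitary_adj.
  by case: eqP => [->|_] //=; rewrite subrr unitr0.
move=> y x z; rewrite !adjE => xy yz.
have -> : x - z = (x - y) - (z - y) by rewrite opprB addrA subrK.
by apply: local_ring_nonunitB => //; rewrite -unitrN opprB.
Qed.
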